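(* Let $m$ and $r$ be two positive integers such that $r\leq m$. Let $\mathcal{M}_1\subseteq\mathbb{R}^{r\times r}$ be the manifold of $r\times r$ real matrices of rank exactly $1$, and let $$\mathcal{B}_{m,r}=\left\{W=W_1\bullet W_2 \;:\; W_1,W_2\in\mathbb{R}^{m\times r},\ W(i,:)\neq 0 \text{ for all } i=1,\dots,m\right\}\subseteq\mathbb{R}^{m\times r^2}.$$ Then $\mathcal{B}_{m,r}$ is a manifold isomorphic to the product of $m$ copies of the vectorized rank-$1$ manifold, that is, $$\mathcal{B}_{m,r}\cong\prod_{i=1}^m \mathrm{vec}(\mathcal{M}_1),\qquad \mathrm{vec}(\mathcal{M}_1)=\{\mathrm{vec}(M): M\in\mathcal{M}_1\}\subseteq\mathbb{R}^{r^2}.$$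
   Context: $W(i,:)$ denotes the $i$th row of $W$. For $W_1\in\mathbb{R}^{m\times r_1}$ with rows $a_1^\top,\dots,a_m^\top$ and $W_2\in\mathbb{R}^{m\times r_2}$ with rows $b_1^\top,\dots,b_m^\top$, the face-splitting product $W_1\bullet W_2\in\mathbb{R}^{m\times(r_1r_2)}$ is the matrix whose $i$th row is $a_i^\top\otimes b_i^\top$, where $\otimes$ is the Kronecker product. The operator $\mathrm{vec}$ stacks the columns of a matrix on top of one another into a single column vector; thus $a_i^\top\otimes b_i^\top=\mathrm{vec}(b_ia_i^\top)^\top$. The isomorphism is understood as an isomorphism of smooth manifolds (diffeomorphism), up to reshaping, i.e. identifying an $m\times r^2$ matrix with the $m$-tuple of its (transposed) rows; $\mathcal{M}_1$ carries its usual structure of embedded submanifold of $\mathbb{R}^{r\times r}$. *)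

(* Defs.v *)
From HB Require Import structures.
From mathcomp Require Import all_boot all_order all_algebra.
From mathcomp Require Import all_classical all_reals all_analysis.
From mathcomp Require Import mxtens.

Set Implicit Arguments.
Unset Strict Implicit.
Unset Printing Implicit Defensive.

Import Order.TTheory GRing.Theory Num.Theory.
Import numFieldNormedType.Exports.

Local Open Scope classical_set_scope.
Local Open Scope ring_scope.

(* Smoothness is meant for finite-dimensional normed spaces (below: spaces of
   matrices), where f is C^(k+1) on an open set iff it is differentiable there
   and all its directional derivatives are C^k. *)
Fixpoint Ck (R : realType) (V W : normedModType R) (k : nat) (U : set V)
    (f : V -> W) : Prop :=
  if k is k'.+1 then
    (forall x, U x -> differentiable f x) /\ (forall v, Ck k' U ('D_v f))
  else forall x, U x -> {for x, continuous f}.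

Definition smooth_on_open (R : realType) (V W : normedModType R) (U : set V)
    (f : V -> W) : Prop :=
  open U /\ forall k, Ck k U f.

(* On an arbitrary subset A of the ambient space: near each point of A, the
   restriction of f to A extends to a smooth map on an open set. *)
Definition smooth_on (R : realType) (V W : normedModType R) (A : set V)
    (f : V -> W) : Prop :=
  forall x, A x -> exists (U : set V) (F : V -> W),
    [/\ U x, smooth_on_open U F & forall y, A y -> U y -> F y = f y].

Definition diffeomorphism (R : realType) (V W : normedModType R) (A : set V)
    (B : set W) (f : V -> W) : Prop :=
  exists g : W -> V,
    [/\ forall x, A x -> B (f x) /\ g (f x) = x,
        forall y, B y -> A (g y) /\ f (g y) = y,
        smooth_on A f & smooth_on B g].

(* Embedded submanifolds, by local parametrizations: every point of S has a
   neighbourhood in S diffeomorphic to an open subset of R^d. *)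
Definition submanifold_dim (R : realType) (V : normedModType R) (d : nat)
    (S : set V) : Prop :=
  forall x, S x -> exists (O : set 'rV[R]_d) (U : set V) (phi : 'rV[R]_d -> V),
    [/\ open O, open U, U x & diffeomorphism O (S `&` U) phi].

Definition submanifold (R : realType) (V : normedModType R) (S : set V) : Prop :=
  exists d, submanifold_dim d S.

(* mxvec concatenates the rows, whence the transpositions. *)
Definition vec (R : Type) (p q : nat) (M : 'M[R]_(p, q)) : 'cV[R]_(q * p) :=
  (mxvec M^T)^T.

(* tensmx is the Kronecker product; the product of two rows has 1 * 1 row. *)
Definition face_splitting (R : pzRingType) (m r1 r2 : nat)
    (W1 : 'M[R]_(m, r1)) (W2 : 'M[R]_(m, r2)) : 'M[R]_(m, r1 * r2) :=
  \matrix_(i, k) (tensmx (row i W1) (row i W2)) (ord0 : 'I_(1 * 1)) k.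

Definition rank_one (R : realType) (r : nat) : set 'M[R]_r :=
  [set M | \rank M = 1%N].

Definition vec_rank_one (R : realType) (r : nat) : set 'cV[R]_(r * r) :=
  [set vec M | M in @rank_one R r].

Definition Bset (R : realType) (m r : nat) : set 'M[R]_(m, r * r) :=
  [set W | (exists W1 W2 : 'M[R]_(m, r), W = face_splitting W1 W2) /\
           forall i, row i W != 0].

(* The product of m copies of S, inside (R^n)^m; an m-tuple of vectors of R^n
   is encoded as the n x m matrix that has them as columns. *)
Definition set_power (R : Type) (m n : nat) (S : set 'cV[R]_n) :
    set 'M[R]_(n, m) :=
  [set X | forall i, S (col i X)].

(* The m-tuple of the transposed rows of W, in the encoding above. *)
Definition rows_tuple (R : Type) (m n : nat) (W : 'M[R]_(m, n)) : 'M[R]_(n, m) :=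
  \matrix_(k, i) (row i W)^T k ord0.

Lemma col_rows_tuple (R : Type) (m n : nat) (W : 'M[R]_(m, n)) (i : 'I_m) :
  col i (rows_tuple W) = (row i W)^T.
Proof. by apply/colP => k; rewrite !mxE. Qed.

Lemma index_allpairs_pair (S T : eqType) (s : seq S) (t : seq T) x y :
  x \in s -> y \in t ->
  index (x, y) [seq (a, b) | a <- s, b <- t] = (index x s * size t + index y t)%N.
Proof.
move=> + yt; elim: s => //= a s IH; rewrite inE index_cat /=.
have [<- _|nxa] := eqVneq a x.
  rewrite map_f // index_map //; last by move=> b c [].
rewrite /= => xs; rewrite IH // size_map.
case: ifP => [/mapP[b _ [e]]|_]; first by rewrite e eqxx in nxa.
by rewrite mulSn addnA.
Qed.

Lemma mxvec_indexE m n (i : 'I_m) (j : 'I_n) :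
  mxvec_index i j = (i * n + j)%N :> nat.
Proof.
rewrite /mxvec_index /= /enum_rank enum_rank_in.unlock insubdK; last first.
  by rewrite -[_ \in _]/(_ < _)%N cardE index_mem mem_enum.
rewrite enumT unlock /= index_allpairs_pair ?mem_enum //.
by rewrite !index_enum_ord size_enum_ord.
Qed.

Lemma row_face_splitting (R : comPzRingType) (m r1 r2 : nat)
    (W1 : 'M[R]_(m, r1)) (W2 : 'M[R]_(m, r2)) (i : 'I_m) :
  row i (face_splitting W1 W2) = (vec ((row i W2)^T *m row i W1))^T.
Proof.
rewrite /vec trmxK; apply/rowP => k; rewrite !mxE.
case: (mxvec_indexP k) => a b; rewrite mxvecE !mxE big_ord1 !mxE mulrC.
have -> : mxvec_index a b = mxtens_index (a, b) by apply/val_inj/mxvec_indexE.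
by rewrite mxtens_indexK.
Qed.

(* Main.v *)
Require Import Defs.
From HB Require Import structures.
From mathcomp Require Import all_boot all_order all_algebra.
From mathcomp Require Import all_classical all_reals all_analysis.

Set Implicit Arguments.
Unset Strict Implicit.
Unset Printing Implicit Defensive.

Import Order.TTheory GRing.Theory Num.Theory.
Import numFieldNormedType.Exports.

Local Open Scope classical_set_scope.
Local Open Scope ring_scope.

(** A face-splitting product has as rows the vectorizations of the matrices
    [b_i *m a_i], and a nonzero matrix is such a column-times-row product
    exactly when it has rank one.  Since [W1] and [W2] choose the [a_i] and
    [b_i] independently for each row, the matrices of the set B_(m,r) are those
    whose transpose has all its columns in [vec_rank_one]
    ([Bset_preimage_trmx]).  The map [rows_tuple] is transposition, so the
    diffeomorphism is a linear isomorphism between the ambient spaces that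
    carries one set onto the other.

    The manifold structures come from the rank-one matrices, through
    constructions that preserve submanifolds.  Near a matrix whose (p, q) entry
    is not zero, a rank-one matrix [M] is determined by its row p and its
    column q, because [M i j = M i q * M p j / M p q]; the r + (r - 1) entries of
    this row and column are free, apart from the pivot being nonzero
    ([submanifold_dim_rank_one]).  Linear isomorphisms ([vec], transposition)
    transport submanifolds ([submanifold_dim_linear]), and a power of a
    submanifold is covered by the products of its charts
    ([submanifold_dim_power]).

    The analysis behind this is elementary: C^k functions are stable under sums,
    products, inverses and composition with linear maps on either side, and
    a matrix-valued function is C^k when its entries are.  No chain rule for two
    nonlinear maps occurs, since charts are only ever composed with linear
    maps. *)

(** * Calculus of C^k functions *)

Section CkCalculus.
Context {R : realType}.
Implicit Types V W : normedModType R.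

Lemma near0_differentiable V W (e : V -> W) (x : V) :
  (\forall y \near x, e y = 0) -> differentiable e x.
Proof.
move=> e0.
have ex0 : e x = 0 by exact: nbhs_singleton e0.
have c0 : continuous (\0 : V -> W) by move=> y; exact: cst_continuous.
have de : e \o shift x = cst (e x) + \0 +o_ 0 id.
  apply/eqaddoP => _/posnumP[eps]; near=> y.
  rewrite !fctE ex0 addr0 subr0.
  have -> : e (shift x y) = 0.
    near: y; have := e0; rewrite (near_shift 0) subr0; exact.
  by rewrite normr0 mulr_ge0.
by apply/diff_locallyP; rewrite (@diff_unique _ _ _ e \0 x c0 de).
Unshelve. all: by end_near. Qed.

(** Differentiability is a local property: [g] is [f] plus a function that
    vanishes near [x]. *)
Lemma near_eq_differentiable V W (f g : V -> W) (x : V) :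
  (\forall y \near x, f y = g y) -> differentiable f x -> differentiable g x.
Proof.
move=> fg df; have -> : g = f + (g - f).
  by apply/funext => y /=; rewrite fctE subrKC.
apply: differentiableD => //; apply: near0_differentiable.
by apply: filterS fg => y fgy; rewrite !fctE fgy subrr.
Qed.

Lemma open_near_eq V W (U : set V) (f g : V -> W) x :
  open U -> (forall y, U y -> f y = g y) -> U x -> \forall y \near x, f y = g y.
Proof.
by move=> oU fg Ux; apply: filterS (open_nbhs_nbhs (conj oU Ux)) => y /fg.
Qed.

(** Openness of [U] is what makes the directional derivatives depend only on the
    values on [U]; this lets the formulas for derivatives, valid only on [U],
    be used in inductions on [k]. *)
Lemma Ck_eq V W k (U : set V) (f g : V -> W) :
  open U -> (forall x, U x -> f x = g x) -> Ck k U f -> Ck k U g.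
Proof.
move=> oU; elim: k f g => [|k IH] f g fg /=.
  move=> cf x Ux; have fgx := open_near_eq oU fg Ux.
  rewrite /prop_for /continuous_at -(fg x Ux).
  exact: cvg_trans (near_eq_cvg fgx) (cf x Ux).
move=> [df Df]; split=> [x Ux|v].
  exact: near_eq_differentiable (open_near_eq oU fg Ux) (df x Ux).
apply: IH (Df v) => x Ux; exact: near_eq_derive (open_near_eq oU fg Ux).
Qed.

Lemma Ck_subset V W k (U U' : set V) (f : V -> W) :
  U' `<=` U -> Ck k U f -> Ck k U' f.
Proof.
move=> UU; elim: k f => [|k IH] f /=; first by move=> cf x /UU; exact: cf.
by move=> [df Df]; split=> [x /UU /df//|v]; exact: IH.
Qed.

Lemma Ck_pred V W k (U : set V) (f : V -> W) : Ck k.+1 U f -> Ck k U f.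
Proof.
elim: k f => [|k IH] f [df Df]; last by split=> // v; exact/IH/Df.
by move=> x /df; exact: differentiable_continuous.
Qed.

Lemma Ck_cst V W k (U : set V) (c : W) : Ck k U (cst c).
Proof.
elim: k c => [|k IH] c /=; first by move=> x _; exact: cst_continuous.
split=> [x _|v]; first exact: differentiable_cst.
have -> : 'D_v (cst c : V -> W) = cst 0 by apply/funext => x; exact: derive_cst.
exact: IH.
Qed.

Lemma Ck_add V W k (U : set V) (f g : V -> W) :
  open U -> Ck k U f -> Ck k U g -> Ck k U (f + g).
Proof.
move=> oU; elim: k f g => [|k IH] f g /=.
  by move=> cf cg x Ux; apply: continuousD; [exact: cf|exact: cg].
move=> [df Df] [dg Dg]; split=> [x Ux|v].
  by apply: differentiableD; [exact: df|exact: dg].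
apply: Ck_eq (IH _ _ (Df v) (Dg v)) => // x Ux.
by rewrite deriveD //; apply: diff_derivable; [exact: df|exact: dg].
Qed.

Lemma Ck_sum V W k (U : set V) (I : Type) (s : seq I) (f : I -> V -> W) :
  open U -> (forall i, Ck k U (f i)) -> Ck k U (\sum_(i <- s) f i).
Proof.
move=> oU cf; elim: s => [|i s IH]; first by rewrite big_nil; exact: Ck_cst.
by rewrite big_cons; exact: Ck_add.
Qed.

(** By induction on [k], as ['D_v (L \o f)] is [L \o 'D_v f]. *)
Lemma Ck_linear_comp V W W' k (U : set V) (L : {linear W -> W'}) (f : V -> W) :
  open U -> continuous L -> Ck k U f -> Ck k U (L \o f).
Proof.
move=> oU cL; elim: k f => [|k IH] f /=.
  by move=> cf x Ux; apply: continuous_comp; [exact: cf|exact: cL].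
move=> [df Df]; have dL y : differentiable L y by exact: linear_differentiable.
split=> [x Ux|v]; first by apply: differentiable_comp; [exact: df|exact: dL].
apply: Ck_eq (IH _ (Df v)) => // x Ux.
rewrite deriveE; last by apply: differentiable_comp; [exact: df|exact: dL].
rewrite diff_comp //; last exact: df.
by rewrite diff_lin //= deriveE //; exact: df.
Qed.

(** By induction on [k], as ['D_v (f \o L)] is ['D_(L v) f \o L]: the direction
    is constant, so that one linear map suffices at every order. *)
Lemma Ck_comp_linear V V' W k (U : set V') (L : {linear V -> V'}) (f : V' -> W) :
  open U -> continuous L -> Ck k U f -> Ck k (L @^-1` U) (f \o L).
Proof.
move=> oU cL; have oLU : open (L @^-1` U) by move/continuousP: cL; apply.
elim: k f => [|k IH] f /=.
  by move=> cf x Ux; apply: continuous_comp; [exact: cL|exact: cf].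
move=> [df Df]; have dL y : differentiable L y by exact: linear_differentiable.
split=> [x Ux|v]; first by apply: differentiable_comp; [exact: dL|exact: df].
apply: Ck_eq (IH _ (Df (L v))) => // x Ux.
rewrite [RHS]deriveE; last by apply: differentiable_comp; [exact: dL|exact: df].
rewrite diff_comp //; last exact: df.
by rewrite (diff_lin x cL) /= deriveE //; exact: df.
Qed.

(** The Leibniz rule needs [f] and [g] themselves to be C^k in order to show
    that the derivative of their product is; [Ck_pred] supplies this. *)
Lemma Ck_mul V k (U : set V) (f g : V -> R) :
  open U -> Ck k U f -> Ck k U g -> Ck k U (f * g).
Proof.
move=> oU; elim: k f g => [|k IH] f g cf cg.
  by move=> x Ux; apply: continuousM; [exact: cf|exact: cg].
have [df Df] := cf; have [dg Dg] := cg; split=> [x Ux|v].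
  by apply: differentiableM; [exact: df|exact: dg].
apply: (@Ck_eq _ _ _ _ (f * 'D_v g + g * 'D_v f)) => // [x Ux|].
  by rewrite deriveM //; apply: diff_derivable; [exact: df|exact: dg].
apply: Ck_add => //; apply: IH.
- exact: Ck_pred cf.
- exact: Dg.
- exact: Ck_pred cg.
- exact: Df.
Qed.

(** The derivative of the inverse is a product of the derivative of [f] with two
    copies of the inverse, which are C^k by induction. *)
Lemma Ck_inv V k (U : set V) (f : V -> R) :
  open U -> (forall x, U x -> f x != 0) -> Ck k U f ->
  Ck k U (fun x => (f x)^-1).
Proof.
move=> oU f0; elim: k => [|k IH] cf.
  by move=> x Ux; apply: continuousV; [exact: f0|exact: cf].
have [df Df] := cf; split=> [x Ux|v].
  by apply: differentiableV; [exact: df|exact: f0].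
pose g : V -> R := fun x => (f x)^-1.
have cg : Ck k U g by exact: IH (Ck_pred cf).
apply: (@Ck_eq _ _ _ _ (cst (-1) * (g * g * 'D_v f))) => // [x Ux|].
  rewrite deriveV //; [|exact: f0|exact/diff_derivable/df].
  by rewrite !fctE mulN1r scaleNr -exprVn expr2.
apply: Ck_mul => //; first exact: Ck_cst.
by apply: Ck_mul => //; [exact: Ck_mul|exact: Df].
Qed.

(** A function with values in a space of matrices is the sum of its
    coordinates times the elementary matrices, so that its regularity can be
    checked coordinatewise. *)
Lemma Ck_mx V k (U : set V) m n (f : V -> 'M[R]_(m, n)) :
  open U -> (forall i j, Ck k U (fun x => f x i j)) -> Ck k U f.
Proof.
move=> oU cf.
have -> : f = \sum_i \sum_j ( *:%R^~ (delta_mx i j) \o (fun x => f x i j)).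
  apply/funext => x; rewrite [LHS]matrix_sum_delta fct_sumE.
  by apply: eq_bigr => i _; rewrite fct_sumE.
apply: Ck_sum => // i; apply: Ck_sum => // j.
have sl : linear ( *:%R^~ (delta_mx i j) : R -> 'M[R]_(m, n)).
  by move=> u y z; rewrite scalerDl scalerA.
pose L : {linear R -> 'M[R]_(m, n)} :=
  HB.pack ( *:%R^~ (delta_mx i j)) (GRing.isLinear.Build _ _ _ _ _ sl).
by apply: (@Ck_linear_comp _ _ _ _ _ L) => //; exact: scalel_continuous.
Qed.

(** A linear map on matrices is a combination of coordinates with constant
    vectors. *)
Lemma linear_mx_continuous W m n (L : {linear 'M[R]_(m, n) -> W}) :
  continuous L.
Proof.
have -> : L = (fun A => \sum_i \sum_j A i j *: L (delta_mx i j)) :> (_ -> _).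
  apply/funext => A; rewrite {1}[A]matrix_sum_delta linear_sum.
  by apply: eq_bigr => i _; rewrite linear_sum; under eq_bigr do rewrite linearZ.
apply: continuous_big => [|i _]; first exact: add_continuous.
apply: continuous_big => [|j _ A]; first exact: add_continuous.
by apply: (cvgZr_tmp (F := nbhs A)); exact: coord_continuous.
Qed.

Lemma Ck_linear V W k (U : set V) (L : {linear V -> W}) :
  continuous L -> Ck k U L.
Proof.
case: k => [|k] cL /=; first by move=> x _; exact: cL.
split=> [x _|v]; first exact: linear_differentiable.
have -> : 'D_v L = cst (L v); last exact: Ck_cst.
apply/funext => x; rewrite deriveE ?diff_lin //; exact: linear_differentiable.
Qed.

(** Coordinates, named so that they can carry a structure of linear map. *)
Definition mx_coord m n (i : 'I_m) (j : 'I_n) (M : 'M[R]_(m, n)) : R := M i j.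

Lemma mx_coord_is_linear m n i j : linear (@mx_coord m n i j).
Proof. by move=> a M N; rewrite /mx_coord !mxE. Qed.

HB.instance Definition _ m n i j :=
  GRing.isLinear.Build _ _ _ _ _ (@mx_coord_is_linear m n i j).

Lemma Ck_coord k m n (U : set 'M[R]_(m, n)) i j : Ck k U (fun M => M i j).
Proof.
exact: (Ck_linear k U (@linear_mx_continuous _ _ _ (@mx_coord m n i j))).
Qed.

End CkCalculus.

(** * Smooth functions on arbitrary subsets *)

Section SmoothOn.
Context {R : realType}.
Implicit Types V W : normedModType R.

Lemma open_forall (T : topologicalType) (I : finType) (U : I -> set T) :
  (forall i, open (U i)) -> open [set x | forall i, U i x].
Proof.
move=> oU; rewrite openE => x Ux; apply: filter_forall => i.
by have := oU i; rewrite openE; apply; exact: Ux.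
Qed.

Lemma smooth_on_openW V W (U : set V) (f : V -> W) :
  smooth_on_open U f -> smooth_on U f.
Proof. by move=> sf x Ux; exists U, f. Qed.

(** The local extensions of the entries live on different neighbourhoods; there
    are finitely many of them, so they have an open intersection. *)
Lemma smooth_on_mx V (A : set V) m n (f : V -> 'M[R]_(m, n)) :
  (forall i j, smooth_on A (fun x => f x i j)) -> smooth_on A f.
Proof.
move=> sf x Ax.
have /choice[UF UFP] : forall ij : 'I_m * 'I_n,
    exists UF : set V * (V -> R), [/\ UF.1 x, smooth_on_open UF.1 UF.2 &
      forall y, A y -> UF.1 y -> UF.2 y = f y ij.1 ij.2].
  by move=> [i j]; have [U [F UF]] := sf i j x Ax; exists (U, F).
have oU : open [set y | forall ij, (UF ij).1 y].
  by apply: open_forall => ij; have [_ []] := UFP ij.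
exists [set y | forall ij, (UF ij).1 y].
exists (fun y => \matrix_(i, j) (UF (i, j)).2 y); split.
- by move=> ij; have [] := UFP ij.
- split=> // k; apply: Ck_mx => // i j.
  have [_ [_ /(_ k) FC] _] := UFP (i, j).
  apply: (@Ck_eq _ _ _ _ _ (UF (i, j)).2) => // [y _|]; first by rewrite mxE.
  by apply: Ck_subset FC => y; exact.
- move=> y Ay Uy; apply/matrixP => i j; rewrite mxE.
  by have [_ _ ->] := UFP (i, j).
Qed.

Lemma smooth_on_linear_comp V W W' (A : set V) (L : {linear W -> W'})
    (f : V -> W) :
  continuous L -> smooth_on A f -> smooth_on A (L \o f).
Proof.
move=> cL sf x Ax; have [U [F [Ux [oU FC] Ff]]] := sf x Ax.
exists U, (L \o F); split=> //; last by move=> y Ay Uy /=; rewrite Ff.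
by split=> // k; exact: Ck_linear_comp.
Qed.

Lemma smooth_on_comp_linear V V' W (A : set V) (B : set V')
    (L : {linear V -> V'}) (f : V' -> W) :
  continuous L -> A `<=` L @^-1` B -> smooth_on B f -> smooth_on A (f \o L).
Proof.
move=> cL AB sf x Ax; have [U [F [Ux [oU FC] Ff]]] := sf _ (AB _ Ax).
exists (L @^-1` U), (F \o L); split=> //; last by move=> y /AB By Uy; exact: Ff.
by split=> [|k]; [move/continuousP: cL; apply|exact: Ck_comp_linear].
Qed.

Lemma smooth_on_coord V (A : set V) m n (f : V -> 'M[R]_(m, n)) i j :
  smooth_on A f -> smooth_on A (fun x => f x i j).
Proof.
apply: (@smooth_on_linear_comp _ _ _ _ (@mx_coord R m n i j)).
exact: linear_mx_continuous.
Qed.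

Lemma smooth_on_linear V W (A : set V) (L : {linear V -> W}) :
  continuous L -> smooth_on A L.
Proof.
move=> cL x Ax; exists setT, L; split=> //.
by split=> [|k]; [exact: openT|exact: Ck_linear].
Qed.

End SmoothOn.

(** * Linear isomorphisms and powers of submanifolds *)

Section Submanifolds.
Context {R : realType}.

Lemma diffeomorphism_linear (V W : normedModType R) (A : set V) (B : set W)
    (L : {linear V -> W}) (L' : {linear W -> V}) :
  continuous L -> continuous L' -> cancel L L' -> cancel L' L ->
  A = L @^-1` B -> diffeomorphism A B L.
Proof.
move=> cL cL' LK L'K ->; exists L'; split=> //; last 2 first.
- exact: smooth_on_linear.
- exact: smooth_on_linear.
by move=> y By; rewrite /= L'K.
Qed.

Lemma submanifold_dim_linear (V W : normedModType R) d (S : set V) (S' : set W)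
    (L : {linear V -> W}) (L' : {linear W -> V}) :
  continuous L -> continuous L' -> cancel L L' -> cancel L' L ->
  S' = L' @^-1` S -> submanifold_dim d S -> submanifold_dim d S'.
Proof.
move=> cL cL' LK L'K -> mS x Sx.
have [D [U [phi [oD oU Ux [g [phiP gP sphi sg]]]]]] := mS _ Sx.
exists D, (L' @^-1` U), (L \o phi); split=> //.
  by move/continuousP: cL'; apply.
exists (g \o L'); split=> [u Du|y Sy||].
- by rewrite /= LK; exact: phiP.
- by rewrite /= (gP _ Sy).2 L'K; split=> //; exact: (gP _ Sy).1.
- exact: smooth_on_linear_comp.
- exact: smooth_on_comp_linear sg.
Qed.

(** The parameters in R^(m d) are cut into m blocks of length d by [vec_mx], and
    the ith block parametrizes the ith column by a chart of [S] around this
    column. *)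
Lemma submanifold_dim_power m n d (S : set 'cV[R]_n) :
  submanifold_dim d S -> submanifold_dim (m * d) (set_power (m := m) S).
Proof.
move=> mS X SX.
have /choice[c cE] : forall i : 'I_m,
    exists c : set 'rV[R]_d * set 'cV[R]_n * ('rV[R]_d -> 'cV[R]_n) *
               ('cV[R]_n -> 'rV[R]_d),
      let: (D, U, phi, g) := c in
      [/\ open D, open U, U (col i X) &
       [/\ forall u, D u -> (S `&` U) (phi u) /\ g (phi u) = u,
           forall y, (S `&` U) y -> D (g y) /\ phi (g y) = y,
           smooth_on D phi & smooth_on (S `&` U) g]].
  move=> i; have [D [U [phi [oD oU Ux [g gP]]]]] := mS _ (SX i).
  by exists (D, U, phi, g).
pose D i := (c i).1.1.1; pose U i := (c i).1.1.2.
pose phi i := (c i).1.2; pose g i := (c i).2.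
(* The property [cE], in terms of the components of the chosen charts. *)
have cP i : [/\ open (D i), open (U i), U i (col i X) &
       [/\ forall u, D i u -> (S `&` U i) (phi i u) /\ g i (phi i u) = u,
           forall y, (S `&` U i) y -> D i (g i y) /\ phi i (g i y) = y,
           smooth_on (D i) (phi i) & smooth_on (S `&` U i) (g i)]].
  by move: (cE i); rewrite /D /U /phi /g; case: (c i) => [[[? ?] ?] ?].
pose P i : {linear 'rV[R]_(m * d) -> 'rV[R]_d} := row i \o vec_mx.
have cPi i : continuous (P i) by exact: linear_mx_continuous.
have ccol i : continuous (col i : 'M[R]_(n, m) -> 'cV[R]_n).
  exact: linear_mx_continuous.
pose Phi (u : 'rV[R]_(m * d)) : 'M[R]_(n, m) := \matrix_(k, i) phi i (P i u) k 0.
pose G (Y : 'M[R]_(n, m)) : 'rV[R]_(m * d) :=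
  mxvec (\matrix_(i, l) g i (col i Y) 0 l).
have colPhi u i : col i (Phi u) = phi i (P i u).
  by apply/colP => k; rewrite !mxE.
have PG Y i : P i (G Y) = g i (col i Y).
  by apply/rowP => l; rewrite /P /= mxvecK !mxE.
exists [set u | forall i, D i (P i u)], [set Y | forall i, U i (col i Y)], Phi.
split.
- apply: open_forall => i; have [oD _ _ _] := cP i.
  by move/continuousP: (cPi i); apply.
- apply: open_forall => i; have [_ oU _ _] := cP i.
  by move/continuousP: (ccol i); apply.
- by move=> i; have [] := cP i.
exists G; split=> [u Du|Y [SY UY]||].
- split; first split=> i /=; rewrite ?colPhi.
  + by have [_ _ _ [/(_ _ (Du i)) [[]]]] := cP i.
  + by have [_ _ _ [/(_ _ (Du i)) [[]]]] := cP i.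
  rewrite -[u in RHS]vec_mxK; congr mxvec; apply/matrixP => i l.
  rewrite mxE colPhi; have [_ _ _ [/(_ _ (Du i)) [_ ->] _ _ _]] := cP i.
  by rewrite /P /= mxE.
- have gY i : D i (g i (col i Y)) /\ phi i (g i (col i Y)) = col i Y.
    by have [_ _ _ [_ + _ _]] := cP i; apply; split; [exact: SY|exact: UY].
  split=> [i|]; first by have := (gY i).1; rewrite -PG.
  by apply/matrixP => k i; rewrite mxE PG (gY i).2 mxE.
- apply: smooth_on_mx => k i; have [_ _ _ [_ _ sphi _]] := cP i.
  have -> : (fun u => Phi u k i) = (fun u => (phi i \o P i) u k 0).
    by apply/funext => u; rewrite mxE.
  apply/smooth_on_coord; apply: (smooth_on_comp_linear (cPi i) _ sphi).
  by move=> u /(_ i).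
- pose G' (Y : 'M[R]_(n, m)) : 'M[R]_(m, d) :=
    \matrix_(i, l) g i (col i Y) 0 l.
  apply: (@smooth_on_linear_comp _ _ _ _ _ (@mxvec R m d) G').
    exact: linear_mx_continuous.
  apply: smooth_on_mx => i l; have [_ _ _ [_ _ _ sg]] := cP i.
  have -> : (fun Y => G' Y i l) = (fun Y => (g i \o col i) Y 0 l).
    by apply/funext => Y; rewrite mxE.
  apply/smooth_on_coord; apply: (smooth_on_comp_linear (ccol i) _ sg).
  by move=> Y [SY UY]; split; [exact: SY|exact: UY].
Qed.

End Submanifolds.

(** * The manifold of rank-one matrices *)

Section RankOne.
Context {R : realType}.

Lemma rank_oneP r (M : 'M[R]_r) :
  rank_one M <-> M != 0 /\ exists (b : 'cV[R]_r) (a : 'rV[R]_r), M = b *m a.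
Proof.
split=> [rM|[M0 [b [a Mba]]]].
  split; first by rewrite -mxrank_eq0 rM.
  move: (col_base M) (row_base M) (mulmx_base M); rewrite rM => b a <-.
  by exists b, a.
apply/eqP; rewrite eqn_leq lt0n mxrank_eq0 M0 andbT Mba.
exact: mulmx_max_rank.
Qed.

(** In the parameter space of dimension r + (r - 1), the first r coordinates are
    the entries of the row of a nonzero pivot, and the others are the entries of
    its column, without the pivot itself. *)
Lemma submanifold_dim_rank_one r : submanifold_dim (r + r.-1) (@rank_one R r).
Proof.
move=> M0 /rank_oneP[M0n0 _].
have [p [q Mpq]] : exists p q, M0 p q != 0.
  apply/not_existsP => M00; move/eqP: M0n0; apply; apply/matrixP => i j.
  by rewrite mxE; apply: contrapT => /eqP Mij; apply: (M00 i); exists j.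
(* The positions, among the parameters, of the entries of row p and of
   column q; the pivot belongs to both. *)
pose rowi : 'I_r -> 'I_(r + r.-1) := lshift r.-1.
pose coli a : 'I_(r + r.-1) :=
  if unlift p a is Some a' then rshift r a' else rowi q.
have colip : coli p = rowi q by rewrite /coli unlift_none.
have colil a : coli (lift p a) = rshift r a by rewrite /coli liftK.
pose D : set 'rV[R]_(r + r.-1) := [set u | u 0 (rowi q) != 0].
pose U : set 'M[R]_r := [set M | M p q != 0].
pose phi (u : 'rV[R]_(r + r.-1)) : 'M[R]_r :=
  \matrix_(a, b) (u 0 (coli a) * u 0 (rowi b) * (u 0 (rowi q))^-1).
pose g (M : 'M[R]_r) : 'rV[R]_(r + r.-1) :=
  row_mx (row p M) (row' p (col q M))^T.
have gl M b : g M 0 (rowi b) = M p b by rewrite /g row_mxEl mxE.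
have gr M a : g M 0 (rshift r a) = M (lift p a) q.
  by rewrite /g row_mxEr !mxE.
have ne0_open m n i j : open [set M : 'M[R]_(m, n) | M i j != 0].
  have -> : [set M : 'M[R]_(m, n) | M i j != 0] =
            (fun M => M i j) @^-1` [set x | x != 0] by [].
  apply: open_comp => [M _|]; first exact: coord_continuous.
  exact: open_neq.
exists D, U, phi; split; [exact: ne0_open|exact: ne0_open|exact: Mpq|].
exists g; split=> [u Du|M [rM UM]||].
- have phip b : phi u p b = u 0 (rowi b).
    by rewrite mxE colip mulrAC divff ?mul1r.
  have phiq a : phi u a q = u 0 (coli a) by rewrite mxE mulfK.
  split; first split.
  + apply/rank_oneP; split.
      by apply/eqP => /matrixP/(_ p q)/eqP; rewrite phip mxE; exact/negP.
    exists (\col_a u 0 (coli a)), (\row_b (u 0 (rowi b) / u 0 (rowi q))).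
    by apply/matrixP => a b; rewrite !mxE big_ord1 !mxE mulrA.
  + by rewrite /U /= phip.
  + apply/rowP => k; case: (split_ordP k) => [b ->|a ->].
      by rewrite gl phip.
    by rewrite gr phiq colil.
- split; first by rewrite /D /= gl.
  have [_ [b [a Mba]]] := (rank_oneP M).1 rM.
  have Mij i j : M i j = b i 0 * a 0 j by rewrite Mba mxE big_ord1.
  have gc i : g M 0 (coli i) = M i q.
    by rewrite /coli; case: unliftP => [i' ->|->]; rewrite ?gr ?gl.
  apply/matrixP => i j; rewrite mxE gc !gl.
  (* Both sides, times the pivot, are b_i * b_p * a_q * a_j. *)
  apply: (mulIf UM); rewrite divfK // !Mij.
  by rewrite mulrACA [a 0 q * _]mulrC mulrACA.
- have oD : open D by exact: ne0_open.
  apply: smooth_on_openW; split=> // k.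
  apply: Ck_mx => // i j.
  pose e l (u : 'rV[R]_(r + r.-1)) : R := u 0 l.
  have ce l : Ck k D (e l) by exact: Ck_coord.
  pose h (u : 'rV[R]_(r + r.-1)) : R := (u 0 (rowi q))^-1.
  have ch : Ck k D h by exact: Ck_inv (ce (rowi q)).
  have -> : (fun u => phi u i j) = e (coli i) * e (rowi j) * h.
    by apply/funext => u; rewrite mxE.
  by apply: Ck_mul => //; exact: Ck_mul.
- apply: smooth_on_mx => i k; rewrite {i}ord1.
  have cc a b : smooth_on (@rank_one R r `&` U) (mx_coord a b).
    by apply: smooth_on_linear; exact: linear_mx_continuous.
  case: (split_ordP k) => [b ->|a ->].
    suff -> : (fun M => g M 0 (lshift r.-1 b)) = mx_coord p b by exact: cc.
    by apply/funext => M; exact: gl.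
  suff -> : (fun M => g M 0 (rshift r a)) = mx_coord (lift p a) q by exact: cc.
  by apply/funext => M; exact: gr.
Qed.

End RankOne.

(** * Face-splitting products and rank-one rows *)

Section Transport.
Context {R : realType}.

Lemma vec_is_linear p q : linear (@vec R p q).
Proof. by move=> a A B; rewrite /vec !linearP. Qed.

Definition unvec p q (v : 'cV[R]_(q * p)) : 'M[R]_(p, q) := (vec_mx v^T)^T.

Lemma unvec_is_linear p q : linear (@unvec p q).
Proof. by move=> a A B; rewrite /unvec !linearP. Qed.

HB.instance Definition _ p q :=
  GRing.isLinear.Build _ _ _ _ _ (@vec_is_linear p q).
HB.instance Definition _ p q :=
  GRing.isLinear.Build _ _ _ _ _ (@unvec_is_linear p q).

Lemma vecK p q : cancel (@vec R p q) (@unvec p q).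
Proof. by move=> M; rewrite /vec /unvec trmxK mxvecK trmxK. Qed.

Lemma unvecK p q : cancel (@unvec p q) (@vec R p q).
Proof. by move=> M; rewrite /vec /unvec trmxK vec_mxK trmxK. Qed.

Lemma vec_rank_one_preimage r : @vec_rank_one R r = @unvec r r @^-1` @rank_one R r.
Proof.
apply/seteqP; split=> [_ [M rM <-]|v rv] /=; first by rewrite vecK.
by exists (unvec v) => //; rewrite unvecK.
Qed.

Lemma rows_tuple_trmx m n (W : 'M[R]_(m, n)) : rows_tuple W = W^T.
Proof. by apply/matrixP => i j; rewrite !mxE. Qed.

(** The rows of [W1] and [W2] are the factors of the rank-one matrices whose
    vectorizations are the rows of [W]; the condition that no row of [W] vanishes
    excludes the rank zero. *)
Lemma Bset_preimage_trmx m r :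
  @Bset R m r = trmx @^-1` (@set_power R m (r * r) (@vec_rank_one R r)).
Proof.
apply/seteqP; split=> W; first move=> [[W1 [W2 WE]] W0] i.
  rewrite -tr_row; exists ((row i W2)^T *m row i W1); last first.
    by rewrite WE row_face_splitting trmxK.
  apply/rank_oneP; split; last by exists (row i W2)^T, (row i W1).
  apply: contra (W0 i) => /eqP M0.
  by rewrite WE row_face_splitting M0 linear0 trmx0.
rewrite /set_power /= => SW.
have /choice[ba baP] : forall i, exists ba : 'cV[R]_r * 'rV[R]_r,
    row i W = (vec (ba.1 *m ba.2))^T /\ ba.1 *m ba.2 != 0.
  move=> i; have := SW i; rewrite -tr_row => -[M /rank_oneP[M0 [b [a Mba]]] vM].
  by exists (b, a); rewrite -Mba vM trmxK.
split=> [|i]; last first.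
  have [-> M0] := baP i; apply: contra M0 => /eqP v0.
  by rewrite -[X in X == 0]vecK -[vec _]trmxK v0 trmx0 linear0.
exists (\matrix_(i, j) (ba i).2 0 j), (\matrix_(i, j) (ba i).1 j 0).
apply/row_matrixP => i; rewrite row_face_splitting (baP i).1.
congr (vec (_ *m _))^T.
  by apply/colP => j; rewrite !mxE.
by apply/rowP => j; rewrite !mxE.
Qed.

End Transport.

Theorem lemma3p2 (R : realType) (m r : nat)
    (m_gt0 : (0 < m)%N) (r_gt0 : (0 < r)%N) (le_rm : (r <= m)%N) :
  [/\ submanifold (@Bset R m r),
      submanifold (@set_power R m (r * r) (@vec_rank_one R r))
    & diffeomorphism (@Bset R m r)
        (@set_power R m (r * r) (@vec_rank_one R r))
        (@rows_tuple R m (r * r))].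
Proof.
have mP : submanifold_dim (m * (r + r.-1))
    (@set_power R m (r * r) (@vec_rank_one R r)).
  apply/submanifold_dim_power.
  apply: submanifold_dim_linear (@submanifold_dim_rank_one R r).
  - exact: (@linear_mx_continuous _ _ _ _ (@vec R r r)).
  - exact: (@linear_mx_continuous _ _ _ _ (@unvec R r r)).
  - exact: vecK.
  - exact: unvecK.
  - exact: vec_rank_one_preimage.
split; last 2 first.
- by exists (m * (r + r.-1))%N.
- have -> : @rows_tuple R m (r * r) = trmx.
    by apply/funext => W; rewrite rows_tuple_trmx.
  apply: (@diffeomorphism_linear R _ _ _ _ trmx trmx) (Bset_preimage_trmx m r).
  - exact: linear_mx_continuous.
  - exact: linear_mx_continuous.
  - exact: trmxK.
  - exact: trmxK.
exists (m * (r + r.-1))%N.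
apply: (@submanifold_dim_linear R _ _ _ _ _ trmx trmx) (Bset_preimage_trmx m r) mP.
- exact: linear_mx_continuous.
- exact: linear_mx_continuous.
- exact: trmxK.
- exact: trmxK.
Qed.
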